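(* Let $\mathbf{X}^1_{\mathrm{lift}},\mathbf{X}^2_{\mathrm{lift}}$ be the noise-free lifted data matrices, $\mathbf{U}$ the input data matrix, $\mathbf{Y}$ the noise-free output data matrix, and let $\hat{\mathbf{X}}^1_{\mathrm{lift}}=\mathbf{X}^1_{\mathrm{lift}}+E_1$, $\hat{\mathbf{X}}^2_{\mathrm{lift}}=\mathbf{X}^2_{\mathrm{lift}}+E_2$, $\hat{\mathbf{Y}}=\mathbf{Y}+M$ be the noisy data matrices (see context). Let $$[A_p,B_p]=\mathbf{X}^2_{\mathrm{lift}}\begin{bmatrix}\mathbf{X}^1_{\mathrm{lift}}\\ \mathbf{U}\end{bmatrix}^{\dagger},\quad C_p=\mathbf{Y}[\mathbf{X}^1_{\mathrm{lift}}]^{\dagger},\qquad [A,B_2]=\hat{\mathbf{X}}^2_{\mathrm{lift}}\begin{bmatrix}\hat{\mathbf{X}}^1_{\mathrm{lift}}\\ \mathbf{U}\end{bmatrix}^{\dagger},\quad C_2=\hat{\mathbf{Y}}[\hat{\mathbf{X}}^1_{\mathrm{lift}}]^{\dagger}$$ be the nominal and the perturbed identified models, and put $\Delta A=A-A_p$, $\Delta B=B_2-B_p$, $\Delta C=C_2-C_p$. With $$S=\begin{bmatrix}\hat{\mathbf{X}}^1_{\mathrm{lift}}-E_1\\ \mathbf{U}\end{bmatrix},\quad T=\begin{bmatrix}\hat{\mathbf{X}}^1_{\mathrm{lift}}\\ \mathbf{U}\end{bmatrix},\quad \mathcal{O}(E)=T^{\dagger}-S^{\dagger},\quad \mathcal{O}(E_1)=[\hat{\mathbf{X}}^1_{\mathrm{lift}}]^{\dagger}-[\hat{\mathbf{X}}^1_{\mathrm{lift}}-E_1]^{\dagger},$$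 one has, in the spectral norm, $$\|[\Delta A,\Delta B]\|\le \|E_2\|\,\|T^{\dagger}\|+\|\hat{\mathbf{X}}^2_{\mathrm{lift}}-E_2\|\,\|\mathcal{O}(E)\|=:U,$$ $$\|\Delta C\|\le\|M\|\,\big\|[\hat{\mathbf{X}}^1_{\mathrm{lift}}]^{\dagger}\big\|+\|\hat{\mathbf{Y}}-M\|\,\|\mathcal{O}(E_1)\|=:V.$$ Consequently, for all vectors $\tilde x,u$ of appropriate dimensions, the model mismatches $f_s=(A\tilde x+B_2u)-(A_p\tilde x+B_pu)$ and $v_s=C_2\tilde x-C_p\tilde x$ satisfy $$\|f_s\|_2\le U\left\|\begin{bmatrix}\tilde x\\ u\end{bmatrix}\right\|_2,\qquad \|v_s\|_2\le V\|\tilde x\|_2 .$$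
   Context: $\dagger$ denotes the Moore–Penrose pseudo-inverse and $\|\cdot\|$ the spectral norm $\|A\|_2=\max_{x\ne0}\|Ax\|_2/\|x\|_2$. A discrete-time nonlinear system $x_{t+1}=f(x_t,u_t)$, $y_t=g(x_t)$ is sampled, giving states $x_0,\dots,x_N$, inputs $\mathbf{U}=[u_1,\dots,u_N]$ and outputs $\mathbf{Y}=[y_1,\dots,y_N]$. The states are lifted by a continuously differentiable vector of basis functions $\psi=[\psi_1,\dots,\psi_M]^T$ (in this formula only, $M$ is the number of basis functions): $$\mathbf{X}^1_{\mathrm{lift}}=[\psi(x_0),\dots,\psi(x_{N-1})],\qquad \mathbf{X}^2_{\mathrm{lift}}=[\psi(x_1),\dots,\psi(x_N)].$$ The states are measured with noise, $\hat x_t=x_t+n_t$, the outputs with noise, $\hat y_t=y_t+m_t$, and the inputs without noise. The lifted noisy data are represented by their first-order expansions $\psi(x_t)+\frac{\partial\psi}{\partial x}(x_t)n_t$, i.e. $\hat{\mathbf{X}}^i_{\mathrm{lift}}=\mathbf{X}^i_{\mathrm{lift}}+E_i$ with $$E_1=\Big[\tfrac{\partial\psi}{\partial x}(x_0)n_0,\dots,\tfrac{\partial\psi}{\partial x}(x_{N-1})n_{N-1}\Big],\qquad E_2=\Big[\tfrac{\partial\psi}{\partial x}(x_1)n_1,\dots,\tfrac{\partial\psi}{\partial x}(x_N)n_N\Big],$$ and $\hat{\mathbf{Y}}=\mathbf{Y}+M$ with $M=[m_1,\dots,m_N]$ (the output noise matrix). *)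

(* Defs.v *)
From HB Require Import structures.
From mathcomp Require Import all_boot all_order all_algebra.
From mathcomp Require Import all_classical all_reals all_analysis.

Set Implicit Arguments.
Unset Strict Implicit.
Unset Printing Implicit Defensive.

Import Order.TTheory GRing.Theory Num.Theory.
Import numFieldNormedType.Exports.

Local Open Scope classical_set_scope.
Local Open Scope ring_scope.

(* The norm `|x| that the library puts on matrices is the max norm; the
   Euclidean norm has to be defined separately. *)
Definition norm2 (R : realType) (n : nat) (x : 'cV[R]_n) : R :=
  Num.sqrt (\sum_i x i 0 ^+ 2).

(* When n > 0 the supremum is a maximum (spectral_norm_max below); when n = 0
   the set is empty and the value is 0. *)
Definition spectral_norm (R : realType) (m n : nat) (A : 'M[R]_(m, n)) : R :=
  sup [set norm2 (A *m x) / norm2 x | x in [set x : 'cV[R]_n | x != 0]].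

(* The four Penrose equations, for real matrices *)
Definition is_pseudoinverse (R : realType) (m n : nat)
    (A : 'M[R]_(m, n)) (X : 'M[R]_(n, m)) : Prop :=
  [/\ A *m X *m A = A, X *m A *m X = X,
      (A *m X)^T = A *m X & (X *m A)^T = X *m A].

(* The default value 0 is never used: see mpinvP and mpinv_unique. The library's
   pinvmx is only a generalised inverse, not the Moore-Penrose one. *)
Definition mpinv (R : realType) (m n : nat) (A : 'M[R]_(m, n)) : 'M[R]_(n, m) :=
  xget 0 [set X | is_pseudoinverse A X].

Definition jacobian_mx (R : realType) (n k : nat)
    (psi : 'cV[R]_n -> 'cV[R]_k) (x : 'cV[R]_n) : 'M[R]_(k, n) :=
  \matrix_(i < k, j < n) 'D_(delta_mx j 0) (fun z => psi z i 0) x.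

Definition continuously_differentiable (R : realType) (n k : nat)
    (psi : 'cV[R]_n -> 'cV[R]_k) : Prop :=
  (forall x, differentiable psi x) /\ continuous (jacobian_mx psi).

(* [v a, v (a + 1), ..., v (a + N - 1)] *)
Definition data_mx (R : realType) (d : nat) (a N : nat) (v : nat -> 'cV[R]_d) :
  'M[R]_(d, N) := \matrix_(i < d, t < N) v (a + t)%N i 0.

Section Helpers.
Variable R : realType.

Lemma sumsq_eq0 n (x : 'cV[R]_n) : \sum_i x i 0 ^+ 2 = 0 -> x = 0.
Proof.
move=> /eqP; rewrite psumr_eq0 => [/allP x0|i _]; last exact: sqr_ge0.
apply/colP => i; rewrite mxE.
by have := x0 i (mem_index_enum i); rewrite sqrf_eq0 => /eqP.
Qed.

Lemma norm2_gt0 n (x : 'cV[R]_n) : x != 0 -> 0 < norm2 x.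
Proof.
move=> x0; rewrite sqrtr_gt0 lt_def sumr_ge0 ?andbT => [|i _]; last exact: sqr_ge0.
by apply: contra x0 => /eqP/sumsq_eq0 ->.
Qed.

Lemma norm2Z n (a : R) (x : 'cV[R]_n) : norm2 (a *: x) = `|a| * norm2 x.
Proof.
rewrite /norm2 -sqrtr_sqr -sqrtrM ?sqr_ge0// mulr_sumr; congr Num.sqrt.
by apply: eq_bigr => i _; rewrite mxE exprMn.
Qed.

Lemma spectral_norm_max m n (A : 'M[R]_(m, n.+1)) :
  exists2 x : 'cV[R]_n.+1, x != 0 & spectral_norm A = norm2 (A *m x) / norm2 x /\
    forall z : 'cV[R]_n.+1, z != 0 ->
      norm2 (A *m z) / norm2 z <= norm2 (A *m x) / norm2 x.
Proof.
pose S := [set w : 'rV[R]_n.+1 | \sum_i w 0 i ^+ 2 = 1].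
have cN : continuous (fun w : 'rV[R]_n.+1 => \sum_i w 0 i ^+ 2).
  apply: (continuous_big add_continuous) => i _ w.
  by apply: continuousM; exact: coord_continuous.
have cS : compact S.
  apply: bounded_closed_compact.
    exists 1; split; first exact: num_real.
    move=> M M1 w /= Sw; apply: (le_trans _ (ltW M1)).
    rewrite [leLHS]/Num.norm/= mx_normrE; apply/bigmax_leP; split => // -[i j] _ /=.
    rewrite ord1 -(@expr_le1 _ 2)// real_normK ?num_real// -Sw.
    by rewrite (bigD1 j)//= lerDl sumr_ge0// => k _; exact: sqr_ge0.
  rewrite (_ : S = (fun w : 'rV[R]_n.+1 => \sum_i w 0 i ^+ 2) @^-1` [set 1]) //.
  by apply: preimage_closed => [w _|]; [exact: cN|exact: closed_eq].
have S0 : S !=set0.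
  exists (delta_mx 0 0); rewrite /S/= (bigD1 ord0)//= big1 => [|i i0].
    by rewrite mxE !eqxx expr1n addr0.
  by rewrite mxE (negbTE i0) andbF expr0n.
have [] := @EVT_max_rV R n.+1 (fun w => norm2 (A *m w^T)) S S0 cS.
  apply: continuous_subspaceT => w.
  have c i : continuous (fun x : 'rV[R]_n.+1 => (A *m x^T) i 0).
    rewrite (_ : (fun x : 'rV[R]_n.+1 => _) =
                 (fun x : 'rV[R]_n.+1 => \sum_j A i j * x 0 j)); last first.
      by apply/funext => x; rewrite mxE; apply: eq_bigr => j _; rewrite mxE.
    apply: (continuous_big add_continuous) => j _ x.
    by apply: continuousM; [exact: cst_continuous|exact: coord_continuous].
  have c2 : continuous (fun x : 'rV[R]_n.+1 => \sum_i (A *m x^T) i 0 ^+ 2).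
    apply: (continuous_big add_continuous) => i _ x.
    by apply: continuousM; exact: c.
  by apply: (continuous_comp (c2 w)); exact: sqrt_continuous.
move=> c; rewrite inE => Sc cmax.
have nc : norm2 c^T = 1.
  rewrite /norm2; under eq_bigr do rewrite mxE.
  by rewrite Sc sqrtr1.
have c0 : c^T != 0.
  apply/eqP => c0; have := nc; rewrite c0 /norm2 big1 => [|i _].
    by rewrite sqrtr0 => /esym/eqP; rewrite oner_eq0.
  by rewrite mxE expr0n.
have ub (z : 'cV[R]_n.+1) : z != 0 ->
    norm2 (A *m z) / norm2 z <= norm2 (A *m c^T) / norm2 c^T.
  move=> z0; have nz := norm2_gt0 z0; rewrite nc divr1.
  have <- : norm2 (A *m ((norm2 z)^-1 *: z)) = norm2 (A *m z) / norm2 z.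
    by rewrite -scalemxAr norm2Z gtr0_norm ?invr_gt0// mulrC.
  have := cmax ((norm2 z)^-1 *: z)^T; rewrite trmxK; apply.
  rewrite inE /S/=; under eq_bigr do rewrite !mxE exprMn.
  rewrite -mulr_sumr exprVn sqr_sqrtr ?sumr_ge0// => [|i _]; last exact: sqr_ge0.
  rewrite mulVf//; apply: contra_neq z0; exact: sumsq_eq0.
exists c^T => //; split=> //; apply/le_anti/andP; split.
  by apply: ge_sup => [|_ [z /= z0 <-]]; [exists (norm2 (A *m c^T) / norm2 c^T), c^T|exact: ub].
apply: ub_le_sup; last by exists c^T.
by exists (norm2 (A *m c^T) / norm2 c^T) => _ [z /= z0 <-]; exact: ub.
Qed.

Lemma gram_unit m n (C : 'M[R]_(m, n)) : row_free C -> C *m C^T \in unitmx.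
Proof.
move=> fC; rewrite -row_free_unit -kermx_eq0; apply/eqP/row_matrixP => i.
rewrite row0; set v := row i _.
have v0 : v *m (C *m C^T) = 0 by apply/sub_kermxP; exact: row_sub.
suff vC : v *m C = 0 by apply: (row_free_inj fC); rewrite vC mul0mx.
apply: trmx_inj; rewrite trmx0; apply: sumsq_eq0.
have : (v *m C *m (v *m C)^T) 0 0 = 0.
  by rewrite trmx_mul mulmxA -(mulmxA v) v0 mul0mx mxE.
rewrite [LHS]mxE => vC; rewrite -[RHS]vC; apply: eq_bigr => j _.
by rewrite expr2 [X in X * _]mxE.
Qed.

Lemma mpinv_exists m n (A : 'M[R]_(m, n)) : exists X, is_pseudoinverse A X.
Proof.
have [r [B [C [-> fB fC]]]] : exists r (B : 'M[R]_(m, r)) (C : 'M[R]_(r, n)),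
    [/\ A = B *m C, row_free B^T & row_free C].
  exists (\rank A), (col_base A), (row_base A); split.
  - by rewrite mulmx_base.
  - by rewrite /row_free mxrank_tr; exact: col_base_full.
  - exact: row_base_free.
pose G := C *m C^T; pose H := B^T *m B.
have uG : G \in unitmx := gram_unit fC.
have uH : H \in unitmx.
  by rewrite /H -{2}(trmxK B); exact: gram_unit.
have sG : (invmx G)^T = invmx G by rewrite trmx_inv /G trmx_mul trmxK.
have sH : (invmx H)^T = invmx H by rewrite trmx_inv /H trmx_mul trmxK.
pose X := C^T *m invmx G *m invmx H *m B^T.
have AX : B *m C *m X = B *m invmx H *m B^T.
  by rewrite /X !mulmxA -(mulmxA B C C^T) -(mulmxA B _ (invmx G)) mulmxV// mulmx1.
have XA : X *m (B *m C) = C^T *m invmx G *m C.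
  rewrite /X !mulmxA -(mulmxA _ B^T B) -(mulmxA _ (invmx H)) mulVmx//.
  by rewrite mulmx1.
exists X; split.
- rewrite AX !mulmxA -(mulmxA _ B^T B) -(mulmxA B (invmx H)) mulVmx//.
  by rewrite mulmx1.
- rewrite XA /X !mulmxA -(mulmxA _ C C^T) -(mulmxA _ (invmx G) (C *m C^T)).
  by rewrite mulVmx// mulmx1.
- by rewrite AX !trmx_mul trmxK sH mulmxA.
- by rewrite XA !trmx_mul trmxK sG mulmxA.
Qed.

Lemma mpinv_unique m n (A : 'M[R]_(m, n)) X Y :
  is_pseudoinverse A X -> is_pseudoinverse A Y -> X = Y.
Proof.
move=> [X1 X2 X3 X4] [Y1 Y2 Y3 Y4].
have AXY : A *m X = A *m Y.
  by rewrite -X3 -{1}Y1 -mulmxA trmx_mul X3 Y3 mulmxA X1.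
have XYA : X *m A = Y *m A.
  by rewrite -X4 -{1}Y1 -(mulmxA A) mulmxA trmx_mul X4 Y4 -mulmxA (mulmxA A) X1.
by rewrite -X2 -Y2 XYA -mulmxA AXY mulmxA.
Qed.

Lemma mpinvP m n (A : 'M[R]_(m, n)) : is_pseudoinverse A (mpinv A).
Proof.
have [X AX] := mpinv_exists A.
exact: (@xgetPex _ 0 [set X | is_pseudoinverse A X] (ex_intro _ X AX)).
Qed.

End Helpers.

(* Main.v *)
(** Both model errors have the form [Z P - (Z - E) Q = E P + (Z - E) (P - Q)], so
    the bounds follow from subadditivity and submultiplicativity of the spectral
    norm. *)

Require Import Defs.
From HB Require Import structures.
From mathcomp Require Import all_boot all_order all_algebra.
From mathcomp Require Import all_classical all_reals all_analysis.
From mathcomp Require Import ring.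

Set Implicit Arguments.
Unset Strict Implicit.
Unset Printing Implicit Defensive.

Import Order.TTheory GRing.Theory Num.Theory.
Import numFieldNormedType.Exports.


Local Open Scope ring_scope.

(** Subtracting the noise from the noisy data recovers the exact data, so the nominal model is
    [(hX2 - E2) *m mpinv S] and the perturbed one is [hX2 *m mpinv T]; the output equation has the
    same shape. Each model error is thus a difference of products [Z *m P - (Z - E) *m Q], in which
    the data error [E] and the pseudo-inverse error [P - Q] separate ([spectral_norm_mulmx_sub]).
    The norm inequalities all come from two facts: [norm2_mulmx_le] makes the spectral norm an
    admissible constant for [A], and [spectral_norm_le] makes it the least nonnegative one. The
    mismatch bounds are [norm2_mulmx_le] applied to the error matrices. *)

Section SpectralNorm.
Variable R : realType.

Lemma norm2_ge0 n (x : 'cV[R]_n) : 0 <= norm2 x.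
Proof. exact: sqrtr_ge0. Qed.

Lemma norm2_0 n : norm2 (0 : 'cV[R]_n) = 0.
Proof. by rewrite -(scale0r 0) norm2Z normr0 mul0r. Qed.

Lemma sqr_norm2 n (x : 'cV[R]_n) : norm2 x ^+ 2 = \sum_i x i 0 ^+ 2.
Proof. by rewrite sqr_sqrtr// sumr_ge0// => i _; exact: sqr_ge0. Qed.

Lemma cauchy_schwarz n (x y : 'cV[R]_n) :
  \sum_i x i 0 * y i 0 <= norm2 x * norm2 y.
Proof.
have [->|x0] := eqVneq x 0.
  by rewrite norm2_0 mul0r big1// => i _; rewrite mxE mul0r.
have [->|y0] := eqVneq y 0.
  by rewrite norm2_0 mulr0 big1// => i _; rewrite mxE mulr0.
have a0 := norm2_gt0 x0; have b0 := norm2_gt0 y0.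
have a2 := sqr_norm2 x; have b2 := sqr_norm2 y.
set a := norm2 x in a0 a2 *; set b := norm2 y in b0 b2 *; set c := \sum_i _.
(* Scaling by the opposite norms gives both vectors length [a * b]; the squared distance is then
   [2 * (a * b) * (a * b - c)], and the positive factor [2 * (a * b)] can be divided out. *)
have : 0 <= \sum_i (b * x i 0 - a * y i 0) ^+ 2.
  by apply: sumr_ge0 => i _; exact: sqr_ge0.
have -> : \sum_i (b * x i 0 - a * y i 0) ^+ 2 = 2 * (a * b) * (a * b - c).
  transitivity (b ^+ 2 * a ^+ 2 + a ^+ 2 * b ^+ 2 - 2 * (a * b) * c); last by ring.
  rewrite {1}a2 {2}b2 /c !mulr_sumr -big_split -sumrB.
  by apply: eq_bigr => i _ /=; ring.
by rewrite pmulr_rge0 ?subr_ge0// !mulr_gt0.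
Qed.

Lemma ler_norm2D n (x y : 'cV[R]_n) : norm2 (x + y) <= norm2 x + norm2 y.
Proof.
rewrite -ler_sqr ?nnegrE ?addr_ge0 ?norm2_ge0// sqrrD !sqr_norm2.
rewrite (_ : \sum_i (x + y) i 0 ^+ 2 =
  \sum_i x i 0 ^+ 2 + (\sum_i x i 0 * y i 0) *+ 2 + \sum_i y i 0 ^+ 2).
  by rewrite lerD2r lerD2l lerMn2r cauchy_schwarz orbT.
by rewrite -sumrMnl -!big_split; apply: eq_bigr => i _; rewrite mxE sqrrD.
Qed.

Lemma spectral_norm_ge0 m n (A : 'M[R]_(m, n)) : 0 <= spectral_norm A.
Proof.
case: n A => [|n] A; last first.
  by have [z _ [-> _]] := spectral_norm_max A; rewrite divr_ge0 ?norm2_ge0.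
(* With no columns there is no nonzero vector, and the supremum of the empty set is 0. *)
rewrite /spectral_norm; set B := (X in sup X).
suff -> : B = set0 by rewrite sup0.
by rewrite -subset0 => _ [x /= + _]; rewrite flatmx0 eqxx.
Qed.

(** The supremum is an attained maximum by [spectral_norm_max], so it dominates the quotient at
    every nonzero [x]. *)
Lemma norm2_mulmx_le m n (A : 'M[R]_(m, n)) (x : 'cV[R]_n) :
  norm2 (A *m x) <= spectral_norm A * norm2 x.
Proof.
have [->|x0] := eqVneq x 0; first by rewrite mulmx0 !norm2_0 mulr0.
case: n A x x0 => [|n] A x x0; first by rewrite flatmx0 eqxx in x0.
have [z _ [-> zmax]] := spectral_norm_max A.
by rewrite -ler_pdivrMr ?norm2_gt0//; exact: zmax.
Qed.

(** The condition [0 <= c] covers [n = 0], where the spectral norm takes the value 0. *)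
Lemma spectral_norm_le m n (A : 'M[R]_(m, n)) (c : R) : 0 <= c ->
  (forall x, norm2 (A *m x) <= c * norm2 x) -> spectral_norm A <= c.
Proof.
move=> c0 Ac; rewrite /spectral_norm.
set B := (X in sup X); have [->|/set0P B0] := eqVneq B set0; first by rewrite sup0.
apply: ge_sup => // _ [x /= x0 <-].
by rewrite ler_pdivrMr ?norm2_gt0.
Qed.

Lemma spectral_normD m n (A B : 'M[R]_(m, n)) :
  spectral_norm (A + B) <= spectral_norm A + spectral_norm B.
Proof.
apply: spectral_norm_le => [|x]; first by rewrite addr_ge0 ?spectral_norm_ge0.
rewrite mulmxDl mulrDl (le_trans (ler_norm2D _ _))//.
by rewrite lerD ?norm2_mulmx_le.
Qed.

Lemma spectral_normM m n l (A : 'M[R]_(m, n)) (B : 'M[R]_(n, l)) :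
  spectral_norm (A *m B) <= spectral_norm A * spectral_norm B.
Proof.
apply: spectral_norm_le => [|x]; first by rewrite mulr_ge0 ?spectral_norm_ge0.
rewrite -mulmxA -mulrA (le_trans (norm2_mulmx_le _ _))//.
by rewrite ler_wpM2l ?spectral_norm_ge0 ?norm2_mulmx_le.
Qed.

Lemma spectral_norm_mulmx_sub m n l (Z E : 'M[R]_(m, n)) (P Q : 'M[R]_(n, l)) :
  spectral_norm (Z *m P - (Z - E) *m Q) <=
  spectral_norm E * spectral_norm P
    + spectral_norm (Z - E) * spectral_norm (P - Q).
Proof.
(* Add and subtract [(Z - E) *m P]. *)
have -> : Z *m P - (Z - E) *m Q = E *m P + (Z - E) *m (P - Q).
  by rewrite mulmxBr addrA -mulmxDl (addrC E) subrK.
by rewrite (le_trans (spectral_normD _ _))// lerD ?spectral_normM.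
Qed.

End SpectralNorm.

Theorem mainTheorem2 (R : realType) (n p q k N : nat)
  (f : 'cV[R]_n -> 'cV[R]_p -> 'cV[R]_n) (g : 'cV[R]_n -> 'cV[R]_q)
  (x : nat -> 'cV[R]_n) (u : nat -> 'cV[R]_p) (y : nat -> 'cV[R]_q)
  (psi : 'cV[R]_n -> 'cV[R]_k)
  (noise_x : nat -> 'cV[R]_n) (noise_y : nat -> 'cV[R]_q)
  (hx : forall t, (t < N)%N -> x t.+1 = f (x t) (u t))
  (hy : forall t, (t <= N)%N -> y t = g (x t))
  (hpsi : continuously_differentiable psi)
  (X1 X2 E1 E2 hX1 hX2 : 'M[R]_(k, N)) (Um : 'M[R]_(p, N))
  (Y M hY : 'M[R]_(q, N))
  (hX1E : X1 = data_mx 0 N (fun t => psi (x t)))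
  (hX2E : X2 = data_mx 1 N (fun t => psi (x t)))
  (hUE : Um = data_mx 1 N u)
  (hYE : Y = data_mx 1 N y)
  (hE1 : E1 = data_mx 0 N (fun t => jacobian_mx psi (x t) *m noise_x t))
  (hE2 : E2 = data_mx 1 N (fun t => jacobian_mx psi (x t) *m noise_x t))
  (hM : M = data_mx 1 N noise_y)
  (hhX1 : hX1 = X1 + E1) (hhX2 : hX2 = X2 + E2) (hhY : hY = Y + M)
  (Ap A : 'M[R]_k) (Bp B2 : 'M[R]_(k, p)) (Cp C2 : 'M[R]_(q, k))
  (hABp : row_mx Ap Bp = X2 *m mpinv (col_mx X1 Um))
  (hCp : Cp = Y *m mpinv X1)
  (hAB : row_mx A B2 = hX2 *m mpinv (col_mx hX1 Um))
  (hC : C2 = hY *m mpinv hX1) :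
  let dA := A - Ap in
  let dB := B2 - Bp in
  let dC := C2 - Cp in
  let S := col_mx (hX1 - E1) Um in
  let T := col_mx hX1 Um in
  let OE := mpinv T - mpinv S in
  let OE1 := mpinv hX1 - mpinv (hX1 - E1) in
  let boundU := spectral_norm E2 * spectral_norm (mpinv T)
                + spectral_norm (hX2 - E2) * spectral_norm OE in
  let boundV := spectral_norm M * spectral_norm (mpinv hX1)
                + spectral_norm (hY - M) * spectral_norm OE1 in
  [/\ spectral_norm (row_mx dA dB) <= boundU,
      spectral_norm dC <= boundV
    & forall (xt : 'cV[R]_k) (v : 'cV[R]_p),
        let fs := (A *m xt + B2 *m v) - (Ap *m xt + Bp *m v) in
        let vs := C2 *m xt - Cp *m xt in
        norm2 fs <= boundU * norm2 (col_mx xt v) /\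
        norm2 vs <= boundV * norm2 xt].
Proof.
move=> dA dB dC S T OE OE1 boundU boundV.
have dAB : row_mx dA dB = hX2 *m mpinv T - (hX2 - E2) *m mpinv S.
  (* Unfolding the noisy data lets the noise cancel in [hX2 - E2] and [hX1 - E1]; the remaining sums
     are folded back so that both identified models can be recognised. *)
  rewrite /S /T hhX2 addrK -hhX2 hhX1 addrK -hhX1 -hAB -hABp.
  by rewrite opp_row_mx add_row_mx.
have dCE : dC = hY *m mpinv hX1 - (hY - M) *m mpinv (hX1 - E1).
  by rewrite hhY addrK -hhY hhX1 addrK -hhX1 -hC -hCp.
have leU : spectral_norm (row_mx dA dB) <= boundU.
  by rewrite dAB; exact: spectral_norm_mulmx_sub.
have leV : spectral_norm dC <= boundV.
  by rewrite dCE; exact: spectral_norm_mulmx_sub.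
split=> // xt v fs vs; split.
  (* The state mismatch is linear in the stacked vector, so the bound on the joint block matrix
     applies directly. *)
  have -> : fs = row_mx dA dB *m col_mx xt v.
    by rewrite mul_row_col !mulmxBl addrACA -opprD.
  by rewrite (le_trans (norm2_mulmx_le _ _))// ler_wpM2r ?norm2_ge0.
rewrite /vs -mulmxBl (le_trans (norm2_mulmx_le _ _))//.
by rewrite ler_wpM2r ?norm2_ge0.
Qed.
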